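(* Consider the centralised market clearing problem (C) and its Lagrangian relaxation $\phi(\pi^g,\pi^e,\pi^h)$ with respect to the balance constraints, as given in the context. Let $(\mu_k)_{k\ge1}$ be a sequence with $\mu_k\ge0$, $\lim_{k\to\infty}\mu_k=0$, $\sum_{k=1}^\infty\mu_k=\infty$ and $\sum_{k=1}^\infty\mu_k^2<\infty$. Consider the iterative process, started from arbitrary initial multipliers, where at each iteration $k$ the values $x_o^{g\,(k)},x_o^{e\,(k)},x_o^{h\,(k)},x_{co}^{g\to e\,(k)},x_{co}^{g\to h\,(k)}$ are obtained by solving the gas, electricity, heat and conversion subproblems with multipliers $\pi^{g\,(k)},\pi^{e\,(k)},\pi^{h\,(k)}$, and the multipliers are updated by $$\pi^{g\,(k+1)}=\pi^{g\,(k)}+\mu_k\Big(\sum_{o\in\mathcal O^g}Q_o^gx_o^{g\,(k)}+\sum_{co\in\mathcal O^{g\to e}}Q_{co}^{g\to e}x_{co}^{g\to e\,(k)}+\sum_{co\in\mathcal O^{g\to h}}Q_{co}^{g\to h}x_{co}^{g\to h\,(k)}\Big),$$ $$\pi^{e\,(k+1)}=\pi^{e\,(k)}+\mu_k\Big(\sum_{o\in\mathcal O^e}Q_o^ex_o^{e\,(k)}-\sum_{co\in\mathcal O^{g\to e}}\eta_{co}^{g\to e}Q_{co}^{g\to e}x_{co}^{g\to e\,(k)}\Big),$$ $$\pi^{h\,(k+1)}=\pi^{h\,(k)}+\mu_k\Big(\sum_{o\in\mathcal O^h}Q_o^hx_o^{h\,(k)}-\sum_{co\in\mathcal O^{g\to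 h}}\eta_{co}^{g\to h}Q_{co}^{g\to h}x_{co}^{g\to h\,(k)}\Big).$$ Then $(\pi^{g\,(k)},\pi^{e\,(k)},\pi^{h\,(k)})\to(\pi^{g*},\pi^{e*},\pi^{h*})$ as $k\to\infty$, where $(\pi^{g*},\pi^{e*},\pi^{h*})$ is an optimal solution of the Lagrangian dual problem $\min_{\pi^g,\pi^e,\pi^h}\phi(\pi^g,\pi^e,\pi^h)$.
   Context: Carriers are gas ($g$), electricity ($e$), heat ($h$). $\mathcal O^c$ is a finite set of elementary orders of carrier $c$, with limit price $P_o^c$, quantity $Q_o^c$ ($<0$ for sell, $>0$ for buy) and acceptance ratio $x_o^c$. $\mathcal O^{g\to e},\mathcal O^{g\to h}$ are finite sets of conversion orders with conversion price $P_{co}$, capacity $Q_{co}>0$, efficiency $\eta_{co}>0$ and acceptance ratio $x_{co}$ (with the corresponding superscript). Problem (C): maximise $$\Theta(x)=\sum_{c\in\{g,e,h\}}\sum_{o\in\mathcal O^c}P_o^cQ_o^cx_o^c-\sum_{co\in\mathcal O^{g\to e}}P_{co}^{g\to e}Q_{co}^{g\to e}x_{co}^{g\to e}-\sum_{co\in\mathcal O^{g\to h}}P_{co}^{g\to h}Q_{co}^{g\to h}x_{co}^{g\to h}$$ subject to the balance constraints $\beta^g(x)=\beta^e(x)=\beta^h(x)=0$ and all variables in $[0,1]$, where $\beta^g(x)=\sum_{o\in\mathcal O^g}Q_o^gx_o^g+\sum_{co\in\mathcal O^{g\to e}}Q_{co}^{g\to e}x_{co}^{g\to e}+\sum_{co\in\mathcal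 O^{g\to h}}Q_{co}^{g\to h}x_{co}^{g\to h}$, $\beta^e(x)=\sum_{o\in\mathcal O^e}Q_o^ex_o^e-\sum_{co\in\mathcal O^{g\to e}}\eta_{co}^{g\to e}Q_{co}^{g\to e}x_{co}^{g\to e}$, $\beta^h(x)=\sum_{o\in\mathcal O^h}Q_o^hx_o^h-\sum_{co\in\mathcal O^{g\to h}}\eta_{co}^{g\to h}Q_{co}^{g\to h}x_{co}^{g\to h}$. Lagrangian relaxation: $\phi(\pi^g,\pi^e,\pi^h)=\max_{0\le x\le1}\{\Theta(x)-\pi^g\beta^g(x)-\pi^e\beta^e(x)-\pi^h\beta^h(x)\}$. For fixed multipliers it splits into the subproblems (all variables in $[0,1]$): Carrier $c\in\{g,e,h\}$: maximise $\sum_{o\in\mathcal O^c}P_o^cQ_o^cx_o^c-\pi^c\sum_{o\in\mathcal O^c}Q_o^cx_o^c$. Conversion: maximise $\sum_{co\in\mathcal O^{g\to e}}(\eta_{co}^{g\to e}\pi^e-\pi^g-P_{co}^{g\to e})Q_{co}^{g\to e}x_{co}^{g\to e}+\sum_{co\in\mathcal O^{g\to h}}(\eta_{co}^{g\to h}\pi^h-\pi^g-P_{co}^{g\to h})Q_{co}^{g\to h}x_{co}^{g\to h}$. At each iteration any optimal solution of each subproblem may be chosen. *)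

(* Defs.v *)
From HB Require Import structures.
From mathcomp Require Import all_boot all_order all_algebra.
From mathcomp Require Import all_classical all_reals all_analysis.
Set Implicit Arguments.
Unset Strict Implicit.
Unset Printing Implicit Defensive.
Import Order.TTheory GRing.Theory Num.Theory.
Import numFieldNormedType.Exports.
Local Open Scope classical_set_scope.
Local Open Scope ring_scope.

Inductive carrier := Gas | Electricity | Heat.

Inductive conversion := GasToElectricity | GasToHeat.

(* Quantities are signed: [qty o < 0] for a sell order, [0 < qty o] for a buy
   order. *)
Record market (R : realType) := Market {
  order_set : carrier -> finType;
  price : forall c, order_set c -> R;
  qty : forall c, order_set c -> R;
  qty_sell_or_buy : forall c (o : order_set c), qty o < 0 \/ 0 < qty o;
  conv_set : conversion -> finType;
  conv_price : forall d, conv_set d -> R;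
  capacity : forall d, conv_set d -> R;
  capacity_gt0 : forall d (co : conv_set d), 0 < capacity co;
  efficiency : forall d, conv_set d -> R;
  efficiency_gt0 : forall d (co : conv_set d), 0 < efficiency co
}.

Section Market.
Variables (R : realType) (M : market R).

Definition carrier_ratios (c : carrier) := order_set M c -> R.
Definition conv_ratios := forall d : conversion, conv_set M d -> R.

Record allocation := Allocation {
  ratio : forall c, carrier_ratios c;
  conv_ratio : conv_ratios
}.

Definition carrier_box (c : carrier) : set (carrier_ratios c) :=
  [set x | forall o, 0 <= x o <= 1].

Definition conv_box : set conv_ratios :=
  [set x | forall d (co : conv_set M d), 0 <= x d co <= 1].

Definition box : set allocation :=
  [set x | (forall c, carrier_box (@ratio x c)) /\ conv_box (conv_ratio x)].

Definition order_value c (x : carrier_ratios c) : R :=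
  \sum_(o : order_set M c) price o * qty o * x o.

Definition order_volume c (x : carrier_ratios c) : R :=
  \sum_(o : order_set M c) qty o * x o.

Definition conv_cost (x : conv_ratios) d : R :=
  \sum_(co : conv_set M d) conv_price co * capacity co * x d co.

Definition conv_input (x : conv_ratios) d : R :=
  \sum_(co : conv_set M d) capacity co * x d co.

Definition conv_output (x : conv_ratios) d : R :=
  \sum_(co : conv_set M d) efficiency co * capacity co * x d co.

Definition welfare (x : allocation) : R :=
  order_value (@ratio x Gas) + order_value (@ratio x Electricity)
    + order_value (@ratio x Heat)
  - conv_cost (conv_ratio x) GasToElectricity
  - conv_cost (conv_ratio x) GasToHeat.

Definition balance (x : allocation) (c : carrier) : R :=
  match c with
  | Gas => order_volume (@ratio x Gas)
           + conv_input (conv_ratio x) GasToElectricity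
           + conv_input (conv_ratio x) GasToHeat
  | Electricity => order_volume (@ratio x Electricity)
                   - conv_output (conv_ratio x) GasToElectricity
  | Heat => order_volume (@ratio x Heat)
            - conv_output (conv_ratio x) GasToHeat
  end.

Definition lagrangian (pi : carrier -> R) (x : allocation) : R :=
  welfare x - pi Gas * balance x Gas - pi Electricity * balance x Electricity
    - pi Heat * balance x Heat.

(* The supremum is a maximum: the Lagrangian is affine in [x] and the box is
   nonempty and compact. *)
Definition dual_function (pi : carrier -> R) : R :=
  sup [set lagrangian pi x | x in box].

Definition dual_optimal (pi : carrier -> R) : Prop :=
  forall rho : carrier -> R, dual_function pi <= dual_function rho.

Definition carrier_objective (pi : carrier -> R) c (x : carrier_ratios c) : R :=
  order_value x - pi c * order_volume x.

Definition conv_objective (pi : carrier -> R) (x : conv_ratios) : R :=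
  \sum_(co : conv_set M GasToElectricity)
    (efficiency co * pi Electricity - pi Gas - conv_price co)
      * capacity co * x GasToElectricity co
  + \sum_(co : conv_set M GasToHeat)
    (efficiency co * pi Heat - pi Gas - conv_price co)
      * capacity co * x GasToHeat co.

Definition is_maximiser (T : Type) (D : set T) (f : T -> R) (x : T) : Prop :=
  D x /\ forall y, D y -> f y <= f x.

Definition solves_subproblems (pi : carrier -> R) (x : allocation) : Prop :=
  (forall c, is_maximiser (@carrier_box c) (carrier_objective pi (c := c))
                          (@ratio x c))
  /\ is_maximiser conv_box (conv_objective pi) (conv_ratio x).

End Market.

(* Main.v *)
Require Import Defs.
From HB Require Import structures.
From mathcomp Require Import all_boot all_order all_algebra.
From mathcomp Require Import all_classical all_reals all_analysis.
From mathcomp Require Import lra ring.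
Set Implicit Arguments.
Unset Strict Implicit.
Unset Printing Implicit Defensive.
Import Order.TTheory GRing.Theory Num.Theory.
Import numFieldNormedType.Exports.
Local Open Scope classical_set_scope.
Local Open Scope ring_scope.

(** The dual function is convex, and minus the balance of a solution of the
    subproblems is a subgradient of it, so the iteration is the subgradient
    method.  For every dual optimum [q], the squared distance to [q] increases
    by at most [3 B^2 mu_k^2] at step [k], where [B] bounds the balances; hence
    the iterates are bounded, and since [mu] is not summable some subsequence of
    dual values tends to the minimum.  A cluster point of that subsequence is
    again a dual optimum, and the same estimate, taken at that point, forces the
    whole sequence to converge to it.

    This needs a dual optimum to start with.  The dual function is a sum of
    positive parts of affine functions, hence a maximum of finitely many affine
    functions, and it is nonnegative.  Fourier-Motzkin elimination of the
    multipliers from [dual_function p <= v] leaves finitely many non-strict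
    affine conditions on [v], so the infimum is attained. *)

(** * Maxima of finitely many affine functions *)

Lemma exists_between (R : realDomainType) (lo hi : seq R) :
  {in lo & hi, forall a b, a <= b} ->
  exists t, {in lo, forall a, a <= t} /\ {in hi, forall b, t <= b}.
Proof.
elim: lo => [|a lo IH] le_lo_hi.
  elim: hi {le_lo_hi} => [|b hi [t [_ t_le]]]; first by exists 0.
  exists (Num.min b t); split=> // c; rewrite inE => /orP[/eqP->|/t_le tc].
    by rewrite ge_min lexx.
  by rewrite ge_min tc orbT.
have [|t [le_t t_le]] := IH.
  by move=> c b c_lo b_hi; apply: le_lo_hi; rewrite // inE c_lo orbT.
exists (Num.max a t); split=> [c|b b_hi].
  rewrite inE => /orP[/eqP->|/le_t ct]; first by rewrite le_max lexx.
  by rewrite le_max ct orbT.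
by rewrite ge_max t_le // andbT le_lo_hi // mem_head.
Qed.

(** [p.2] is the coefficient of the eliminated variable. Conditions free of it are kept, and each
    pair with coefficients of opposite sign is combined with positive weights so that it cancels.
    [s'] is fixed before [ev], so one elimination serves every value of the remaining variables. *)
Lemma fourier_motzkin (R : realFieldType) (W : lmodType R) (s : seq (W * R)) :
  exists s' : seq W, forall ev : W -> R,
    (forall a b u v, ev (a *: u - b *: v) = a * ev u - b * ev v) ->
    (exists t, {in s, forall p, ev p.1 + p.2 * t <= 0}) <->
    {in s', forall w, ev w <= 0}.
Proof.
pose pos := [seq p <- s | 0 < p.2]; pose neg := [seq p <- s | p.2 < 0].
exists ([seq p.1 | p <- [seq p <- s | p.2 == 0]] ++
        [seq p.2 *: q.1 - q.2 *: p.1 | p <- pos, q <- neg]) => ev ev_lin.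
split=> [[t s_le] w|s'_le].
  rewrite mem_cat => /orP[/mapP[p]|/allpairsP[[p q]]].
    rewrite mem_filter => /andP[/eqP p0 ps] ->.
    by have := s_le _ ps; rewrite p0 mul0r addr0.
  rewrite /pos /neg /= !mem_filter => -[/andP[p0 ps] /andP[q0 qs] ->].
  have := s_le _ ps; have := s_le _ qs; rewrite ev_lin; nra.
(* Negative coefficients give lower bounds on [t], positive ones upper bounds; the combined
   conditions say that each lower bound is below each upper bound. *)
have [|t [le_t t_le]] := @exists_between _ [seq - ev q.1 / q.2 | q <- neg]
    [seq - ev p.1 / p.2 | p <- pos].
  move=> _ _ /mapP[q qn ->] /mapP[p pp ->].
  have : ev (p.2 *: q.1 - q.2 *: p.1) <= 0.
    apply: s'_le; rewrite mem_cat; apply/orP; right.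
    by apply/allpairsP; exists (p, q).
  move: qn pp; rewrite !mem_filter => /andP[q0 _] /andP[p0 _].
  rewrite ev_lin ler_pdivlMr // mulrAC ler_ndivrMr //; nra.
exists t => p ps; case: (ltrgtP p.2 0) => [p0|p0|p0].
- have := le_t (- ev p.1 / p.2); rewrite ler_ndivrMr // => le_p.
  by have := le_p (map_f _ _); rewrite mem_filter p0 ps => /(_ isT); nra.
- have := t_le (- ev p.1 / p.2); rewrite ler_pdivlMr // => le_p.
  by have := le_p (map_f _ _); rewrite mem_filter p0 ps => /(_ isT); nra.
- rewrite p0 mul0r addr0; apply: s'_le; rewrite mem_cat map_f //.
  by rewrite mem_filter p0 eqxx ps.
Qed.

Lemma closed_halflines_inf (R : realType) (s : seq (R^o * R^o)) (m v0 : R) :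
  let S := [set v | {in s, forall w, w.1 + w.2 * v <= 0}] in
  S v0 -> lbound S m -> S (inf S).
Proof.
move=> S Sv0 Sm w ws; rewrite leNgt; apply/negP => w_gt0.
have w2_gt0 : 0 < `|w.2| + 1 by rewrite ltr_wpDl.
(* A condition violated at [inf S] stays violated within this distance, where points of [S] must
   exist. The [+ 1] covers [w.2 = 0]. *)
have [||v Sv v_lt] := @inf_adherent _ S ((w.1 + w.2 * inf S) / (`|w.2| + 1)).
- exact: divr_gt0.
- by split; [exists v0 | exists m].
have v_ge : inf S <= v by apply: ge_inf => //; exists m.
have := Sv _ ws.
move: v_lt; rewrite -ltrBlDl ltr_pdivlMr //.
have := ler_norm (- w.2); rewrite normrN; nra.
Qed.

(* [w] lists the constant term and the coefficients of gas, electricity, heat. *)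
Definition affine (R : realType) (w : R^o * R^o * R^o * R^o) (p : carrier -> R) : R :=
  w.1.1.1 + w.1.1.2 * p Gas + w.1.2 * p Electricity + w.2 * p Heat.

(** Phrased through the epigraph, which is the system of inequalities that elimination acts on. *)
Definition max_affine (R : realType) (f : (carrier -> R) -> R) :=
  exists s : seq (R^o * R^o * R^o * R^o), forall p v,
    f p <= v <-> {in s, forall w, affine w p <= v}.

Lemma max_affine_pos (R : realType) (f : (carrier -> R) -> R) w :
  f =1 affine w -> max_affine (fun p => Num.max 0 (f p)).
Proof.
move=> fw; exists [:: 0; w] => p v; rewrite fw ge_max; split=> [/andP[v0 wv] u|s_le].
  by rewrite !inE => /orP[] /eqP -> //; rewrite /affine /= !mul0r !addr0.
have := s_le 0; rewrite mem_head /affine /= !mul0r !addr0 => -> //=.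
by apply: s_le; rewrite !inE eqxx orbT.
Qed.

(** A sum of two maxima is the maximum of all pairwise sums. *)
Lemma max_affineD (R : realType) f g :
  max_affine f -> max_affine g -> @max_affine R (fun p => f p + g p).
Proof.
move=> [s fs] [t gt]; exists [seq u + w | u <- s, w <- t] => p v.
have affD u w : affine (u + w) p = affine u p + affine w p.
  by rewrite /affine /=; ring.
split=> [fg_le _ /allpairsP[[u w] /= [us wt ->]]|st_le].
  rewrite affD (le_trans _ fg_le) // lerD //; first exact: (fs p _).1.
  exact: (gt p _).1.
rewrite -lerBrDl; apply/gt => w wt; rewrite lerBrDl -lerBrDr; apply/fs => u us.
by rewrite lerBrDr -affD st_le //; apply/allpairsP; exists (u, w).
Qed.

Lemma max_affine_sum (R : realType) (I : finType) (f : I -> (carrier -> R) -> R) :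
  (forall i, max_affine (f i)) -> @max_affine R (fun p => \sum_i f i p).
Proof.
move=> f_aff.
suff : @max_affine R (\sum_i f i).
  by congr max_affine; apply/funext => p; rewrite fct_sumE.
elim/big_ind: _ => [|g h|//]; last exact: max_affineD.
exists [:: 0] => p v; split=> [v0 w|s_le].
  by rewrite inE => /eqP ->; rewrite /affine /= !mul0r !addr0.
by have := s_le 0; rewrite mem_head /affine /= !mul0r !addr0; apply.
Qed.

Lemma max_affine_min (R : realType) (f : (carrier -> R) -> R) (m : R) :
  max_affine f -> (forall p, m <= f p) ->
  exists p, forall q, f p <= f q.
Proof.
move=> [s fs] f_ge.
(* The condition [affine w p - v <= 0], with entries ordered constant, [v], gas, electricity, heat.
   Elimination removes the last entry each time, so [v] alone survives in [s0]. *)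
pose s3 : seq (R^o * R^o * R^o * R^o * R) :=
  [seq (w.1.1.1, -1, w.1.1.2, w.1.2, w.2) | w <- s].
have [s2 elim2] := @fourier_motzkin R _ s3.
have [s1 elim1] := @fourier_motzkin R _ s2.
have [s0 elim0] := @fourier_motzkin R _ s1.
pose S := [set v | {in s0, forall w, w.1 + w.2 * v <= 0}].
have SE v : S v <-> exists p, f p <= v.
  have ev0 := elim0 (fun w => w.1 + w.2 * v).
  have {}ev0 := ev0 (fun a b u w => ltac:(rewrite /= /GRing.scale /=; ring)).
  rewrite /S /=; split.
    move=> /ev0[x]; have ev1 := elim1 (fun w => w.1.1 + w.1.2 * v + w.2 * x).
    have {}ev1 := ev1 (fun a b u w => ltac:(rewrite /= /GRing.scale /=; ring)).
    move=> /ev1[y].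
    have ev2 := elim2 (fun w => w.1.1.1 + w.1.1.2 * v + w.1.2 * x + w.2 * y).
    have {}ev2 := ev2 (fun a b u w => ltac:(rewrite /= /GRing.scale /=; ring)).
    move=> /ev2[z s3_le].
    exists (fun c => match c with Gas => x | Electricity => y | Heat => z end).
    by apply/fs => w ws; have := s3_le _ (map_f _ ws); rewrite /affine /=; lra.
  move=> [p /fs s_le]; apply/ev0; exists (p Gas).
  apply/(elim1 (fun w => w.1.1 + w.1.2 * v + w.2 * p Gas)).
    by move=> a b u w; rewrite /= /GRing.scale /=; ring.
  exists (p Electricity).
  apply/(elim2 (fun w => w.1.1.1 + w.1.1.2 * v + w.1.2 * p Gas
                         + w.2 * p Electricity)).
    by move=> a b u w; rewrite /= /GRing.scale /=; ring.
  exists (p Heat) => _ /mapP[w ws ->].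
  by have := s_le _ ws; rewrite /affine /=; lra.
have Slb : lbound S m.
  by move=> v /SE[p fp]; apply: le_trans fp.
have S0 : S (f (fun=> 0)) by apply/SE; exists (fun=> 0).
have /SE[p fp] := @closed_halflines_inf _ s0 _ _ S0 Slb.
exists p => q; apply: le_trans fp _; apply: ge_inf; first by exists m.
by apply/SE; exists q.
Qed.

(** * The subgradient method *)

Definition dot (R : realType) (u v : carrier -> R) : R :=
  u Gas * v Gas + u Electricity * v Electricity + u Heat * v Heat.

Definition sqdist (R : realType) (p q : carrier -> R) : R :=
  dot (fun c => p c - q c) (fun c => p c - q c).

Lemma sqdist_ge0 (R : realType) (p q : carrier -> R) : 0 <= sqdist p q.
Proof. by rewrite /sqdist /dot !addr_ge0 // -expr2 sqr_ge0. Qed.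

Lemma le_sqdist (R : realType) (p q : carrier -> R) c :
  (p c - q c) ^+ 2 <= sqdist p q.
Proof.
rewrite /sqdist /dot.
by case: c; have := sqr_ge0 (p Gas - q Gas);
  have := sqr_ge0 (p Electricity - q Electricity);
  have := sqr_ge0 (p Heat - q Heat); lra.
Qed.

(** Compactness of a cube, with points written as triples to use products of segments. *)
Lemma bounded_seq_cluster (R : realType) (p : nat -> carrier -> R) (b : R) :
  (forall n c, `|p n c| <= b) ->
  exists q : carrier -> R, forall (e : R) N, 0 < e ->
    exists2 n, (N <= n)%N & forall c, `|p n c - q c| < e.
Proof.
move=> p_le.
have cK := @segment_compact R (- b) b.
have [|[[x y] z] [_ xyz]] := compact_setX (compact_setX cK cK) cK
  (@fmap_proper_filter _ _
    (fun n => (p n Gas, p n Electricity, p n Heat)) \oo _).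
  by exists 0%N => // n _; rewrite /= !in_itv /= -!ler_norml !p_le.
exists (fun c => match c with Gas => x | Electricity => y | Heat => z end).
move=> e N e0.
have [||_ [[n /= Nn <-] [[]]]] := xyz
  [set (p n Gas, p n Electricity, p n Heat) | n in [set n | (N <= n)%N]]
  (ball (x, y, z) e).
- by exists N => // n /= Nn; exists n.
- exact: nbhsx_ballx.
rewrite /ball /= => px py pz; exists n => // c.
by case: c; rewrite distrC.
Qed.

Section SubgradientMethod.
Context (R : realType) (f : (carrier -> R) -> R) (B L : R) (mu : nat -> R).
Context (p g : nat -> carrier -> R).
Hypothesis mu_ge0 : forall k, 0 <= mu k.
Hypothesis p_step : forall k c, p k.+1 c = p k c + mu k * g k c.
Hypothesis subgradient :
  forall k q, f (p k) + dot (fun c => p k c - q c) (g k) <= f q.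
Hypothesis g_le : forall k c, `|g k c| <= B.

Let sqmu n := \sum_(0 <= k < n) mu k ^+ 2.

Let B2_ge0 : 0 <= 3 * B ^+ 2.
Proof. by rewrite mulr_ge0 // sqr_ge0. Qed.

Let sqmuS n : sqmu n.+1 = sqmu n + mu n ^+ 2.
Proof. by rewrite /sqmu big_nat_recr. Qed.

Let le_sqmu m n : (m <= n)%N -> sqmu m <= sqmu n.
Proof.
move=> mn; rewrite /sqmu [leRHS](big_cat_nat (n := m)) ?leq0n //= lerDl.
by apply: sumr_ge0 => k _; exact: sqr_ge0.
Qed.

(** Expand the square: the subgradient inequality bounds the cross term, and each of the three
    carriers contributes at most [B ^+ 2] to the quadratic one. *)
Lemma sqdist_step k q :
  sqdist (p k.+1) q <=
  sqdist (p k) q - 2 * mu k * (f (p k) - f q) + 3 * B ^+ 2 * mu k ^+ 2.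
Proof.
have sg := subgradient k q.
have g2 c : g k c ^+ 2 <= B ^+ 2.
  by rewrite -real_normK ?num_real // lerXn2r // nnegrE (le_trans _ (g_le k c)).
have g2_le : mu k ^+ 2 * (g k Gas ^+ 2 + g k Electricity ^+ 2 + g k Heat ^+ 2)
    <= mu k ^+ 2 * (3 * B ^+ 2).
  apply: ler_wpM2l; first exact: sqr_ge0.
  by have := g2 Gas; have := g2 Electricity; have := g2 Heat; lra.
have sg_le : mu k * (f (p k) + dot (fun c => p k c - q c) (g k)) <= mu k * f q.
  exact: ler_wpM2l.
move: g2_le sg_le; rewrite /sqdist /dot !p_step; nra.
Qed.

Lemma sqdist_quasi_fejer q m n : (forall r, f q <= f r) -> (m <= n)%N ->
  sqdist (p n) q <= sqdist (p m) q + 3 * B ^+ 2 * (sqmu n - sqmu m).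
Proof.
move=> q_min; elim: n => [|n IH].
  by rewrite leqn0 => /eqP ->; rewrite subrr mulr0 addr0.
rewrite leq_eqVlt => /predU1P[->|]; first by rewrite subrr mulr0 addr0.
rewrite ltnS => /IH {}IH; apply: le_trans (sqdist_step _ _) _.
have : 0 <= mu n * (f (p n) - f q) by rewrite mulr_ge0 // subr_ge0.
rewrite sqmuS; nra.
Qed.

Hypothesis mu_sum : forall A, exists n, A < \sum_(0 <= k < n) mu k.
Hypothesis mu_sum_sqr : has_ubound (range sqmu).

(** Otherwise every step after [N] would lower the squared distance by [2 * e * mu k], up to a
    summable error, and the partial sums of [mu] would be bounded. *)
Lemma subgradient_frequently_near_min q e N : (forall r, f q <= f r) -> 0 < e ->
  exists2 k, (N <= k)%N & f (p k) < f q + e.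
Proof.
move=> q_min e0; apply: contrapT => no_k.
have f_ge k : (N <= k)%N -> f q + e <= f (p k).
  by move=> Nk; rewrite leNgt; apply/negP => fk; apply: no_k; exists k.
have descent n : (N <= n)%N -> sqdist (p n) q
    + 2 * e * (\sum_(0 <= k < n) mu k - \sum_(0 <= k < N) mu k)
    <= sqdist (p N) q + 3 * B ^+ 2 * (sqmu n - sqmu N).
  elim: n => [|n IH].
    by rewrite leqn0 => /eqP ->; rewrite !subrr !mulr0.
  rewrite leq_eqVlt => /predU1P[->|]; first by rewrite !subrr !mulr0.
  rewrite ltnS => Nn; have := IH Nn; have := sqdist_step n q.
  have : mu n * e <= mu n * (f (p n) - f q).
    by rewrite ler_wpM2l // lerBrDl f_ge.
  by rewrite sqmuS big_nat_recr //=; nra.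
have [C sqmu_le] := mu_sum_sqr.
have sqmu_leC n : sqmu n <= C by apply: sqmu_le; exists n.
(* [K] bounds the right-hand side of [descent], so the steps after [N] can sum to at most
   [K / (2 * e)]. *)
pose K := sqdist (p N) q + 3 * B ^+ 2 * C.
have [n] := mu_sum (\sum_(0 <= k < N) mu k + K / (2 * e)).
have [Nn|/ltnW nN] := leqP N n; last first.
  rewrite (big_cat_nat (n := n)) ?leq0n //= => mu_lt.
  have : 0 <= \sum_(n <= k < N) mu k by apply: sumr_ge0.
  have : 0 <= K / (2 * e).
    apply: divr_ge0; last by rewrite mulr_ge0 // ltW.
    rewrite /K addr_ge0 ?sqdist_ge0 //.
    have : 0 <= C by rewrite (le_trans _ (sqmu_leC 0%N)) // /sqmu big_geq.
    exact: mulr_ge0.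
  lra.
rewrite -ltrBrDl ltr_pdivrMr ?mulr_gt0 // => K_lt.
have := descent n Nn; have := sqdist_ge0 (p n) q.
have : 0 <= sqmu N by apply: sumr_ge0 => k _; exact: sqr_ge0.
have := sqmu_leC n; have := sqr_ge0 B; rewrite /K in K_lt; nra.
Qed.

Hypothesis f_lipschitz : forall q r, f q <= f r +
  L * (`|r Gas - q Gas| + `|r Electricity - q Electricity| + `|r Heat - q Heat|).

Lemma sqmu_tail e : 0 < e ->
  exists N, forall m n, (N <= m)%N -> (m <= n)%N -> sqmu n - sqmu m < e.
Proof.
move=> e0; have [_ [N _ <-] N_gt] : exists2 s, range sqmu s & sup (range sqmu) - e < s.
  by apply: sup_adherent => //; split=> //; exists (sqmu 0), 0%N.
exists N => m n Nm mn.
have : sqmu n <= sup (range sqmu) by apply: ub_le_sup => //; exists n.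
have := le_sqmu Nm; lra.
Qed.

Theorem subgradient_method_cvg : (exists q, forall r, f q <= f r) ->
  exists2 q, (forall r, f q <= f r) & forall c, p k c @[k --> \oo] --> q c.
Proof.
move=> [q0 q0_min].
have B_ge0 := le_trans (normr_ge0 _) (g_le 0 Gas).
pose E n : R := n.+1%:R^-1.
(* The indices [i n] need not increase; [n <= i n] is enough to reach arbitrarily late iterates. *)
have /choice[i iP] n : exists k, (n <= k)%N /\ f (p k) < f q0 + E n.
  have [|k nk fk] := @subgradient_frequently_near_min q0 (E n) n q0_min.
    by rewrite invr_gt0.
  by exists k.
have [b b_ge] : exists b, forall n c, `|p n c| <= b.
  have [C sqmu_le] := mu_sum_sqr.
  have sqmu_leC n : sqmu n <= C by apply: sqmu_le; exists n.
  pose K := sqdist (p 0) q0 + 3 * B ^+ 2 * C.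
  (* A nonnegative number whose square is at most [K] is at most [K + 1], which avoids a square
     root. *)
  exists (K + 1 + (`|q0 Gas| + `|q0 Electricity| + `|q0 Heat|)) => n c.
  have : `|p n c| <= `|p n c - q0 c| + `|q0 c|.
    by rewrite -[in leLHS](subrK (q0 c) (p n c)) ler_normD.
  have q0c : `|q0 c| <= `|q0 Gas| + `|q0 Electricity| + `|q0 Heat|.
    have := normr_ge0 (q0 Gas); have := normr_ge0 (q0 Electricity).
    by have := normr_ge0 (q0 Heat); case: c; lra.
  have : `|p n c - q0 c| ^+ 2 <= K.
    rewrite real_normK ?num_real //.
    apply: le_trans (le_sqdist _ _ c) _.
    apply: le_trans (sqdist_quasi_fejer q0_min (leq0n n)) _.
    by rewrite lerD2l ler_wpM2l // {2}/sqmu big_geq // subr0.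
  by have := normr_ge0 (p n c - q0 c); nra.
have [q q_cluster] := @bounded_seq_cluster R (fun n => p (i n)) b (fun n => b_ge _).
have q_min r : f q <= f r.
  apply: le_trans (q0_min r); apply/ler_addgt0Pr => e e0.
  (* Half of [e] pays for the Lipschitz error over three coordinates, the other half for [E n]. The
     sign of [L] is not known, hence the absolute value. *)
  pose d := e / 2 / (3 * (`|L| + 1)).
  have d0 : 0 < d.
    by rewrite divr_gt0 ?divr_gt0 // mulr_gt0 // ltr_wpDl.
  have [N _ N_lt] : \forall n \near \oo, E n < e / 2.
    by apply: near_infty_natSinv_lt (PosNum (divr_gt0 e0 _)).
  have [n Nn near_q] := q_cluster d N d0.
  have := N_lt _ Nn; have [_] := iP n.
  have := f_lipschitz q (p (i n)).
  have dE : d * (3 * (`|L| + 1)) = e / 2.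
    by rewrite divfK // gt_eqF // mulr_gt0 // ltr_wpDl.
  set S := _ + _ + _.
  have S_le : S <= 3 * d.
    by rewrite /S; have := near_q Gas; have := near_q Electricity;
      have := near_q Heat; lra.
  have S_ge : 0 <= S by rewrite !addr_ge0.
  have : L * S <= `|L| * S by rewrite ler_wpM2r // ler_norm.
  have : `|L| * S <= `|L| * (3 * d) by rewrite ler_wpM2l.
  rewrite /=; lra.
exists q => // c; apply/cvgrPdist_lt => e e0.
(* The budget [e ^+ 2] is split between the tail of the squared steps and the distance at index
   [i n]; the [+ 1] allows [B = 0]. *)
have tail_gt0 : 0 < e ^+ 2 / 2 / (3 * B ^+ 2 + 1).
  by rewrite !divr_gt0 ?exprn_gt0 // ltr_wpDl.
have [N tailN] := sqmu_tail tail_gt0.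
(* A difference below 1 dominates its square, so each of the three squares stays below
   [e ^+ 2 / 6]. *)
pose d := Num.min 1 (e ^+ 2 / 6).
have d0 : 0 < d by rewrite lt_min ltr01 divr_gt0 ?exprn_gt0.
have [n Nn near_q] := q_cluster d N d0.
have [n_le _] := iP n.
exists (i n) => // k /= nk.
have := sqdist_quasi_fejer q_min nk.
have := tailN _ _ (leq_trans Nn n_le) nk.
rewrite ltr_pdivlMr; last by rewrite ltr_wpDl.
have sq_le c' : (p (i n) c' - q c') ^+ 2 < e ^+ 2 / 6.
  have := near_q c'; rewrite /d lt_min => /andP[lt1 lt6].
  rewrite -real_normK ?num_real //.
  by have := normr_ge0 (p (i n) c' - q c'); nra.
have : sqdist (p (i n)) q < e ^+ 2 / 2.
  have := sq_le Gas; have := sq_le Electricity; have := sq_le Heat.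
  by rewrite /sqdist /dot; lra.
have : 0 <= sqmu k - sqmu (i n).
  by rewrite subr_ge0 le_sqmu.
have := le_sqdist (p k) q c; rewrite -real_normK ?num_real // distrC => *.
by rewrite -(@ltr_pXn2r _ 2) ?nnegrE ?(ltW e0) //; lra.
Qed.

End SubgradientMethod.

(** * The dual function of the market *)

Section Dual.
Context (R : realType) (M : market R).
Implicit Types (p q : carrier -> R) (x y : allocation M).

Definition conv_target (d : conversion) : carrier :=
  match d with GasToElectricity => Electricity | GasToHeat => Heat end.

(* Unqualified, [order_set] is the one of mathcomp's fingraph. *)
Definition order_gain p c (o : Defs.order_set M c) : R := (price o - p c) * qty o.

Definition conv_gain p d (co : conv_set M d) : R :=
  (efficiency co * p (conv_target d) - p Gas - conv_price co) * capacity co.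

Lemma carrier_objectiveE p c (y : carrier_ratios M c) :
  carrier_objective p y = \sum_o order_gain p o * y o.
Proof.
rewrite /carrier_objective /order_value /order_volume mulr_sumr -sumrB.
by apply: eq_bigr => o _; rewrite /order_gain; ring.
Qed.

Lemma conv_objectiveE p (y : conv_ratios M) :
  conv_objective p y =
  (\sum_co @conv_gain p GasToElectricity co * y GasToElectricity co)
  + \sum_co @conv_gain p GasToHeat co * y GasToHeat co.
Proof. by []. Qed.

Lemma conv_gain_sumE p d (y : conv_ratios M) :
  \sum_co @conv_gain p d co * y d co =
  p (conv_target d) * conv_output y d - p Gas * conv_input y d - conv_cost y d.
Proof.
rewrite /conv_output /conv_input /conv_cost !mulr_sumr -!sumrB.
by apply: eq_bigr => co _; rewrite /conv_gain; ring.
Qed.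

(** Regrouping the terms by variable instead of by constraint splits the Lagrangian into the four
    subproblems. *)
Lemma lagrangianE p x :
  lagrangian p x =
  carrier_objective p (Defs.ratio x (c := Gas))
  + carrier_objective p (Defs.ratio x (c := Electricity))
  + carrier_objective p (Defs.ratio x (c := Heat))
  + conv_objective p (conv_ratio x).
Proof.
rewrite conv_objectiveE !conv_gain_sumE /carrier_objective /lagrangian /welfare.
by rewrite /balance /=; ring.
Qed.

(** For fixed [x] the Lagrangian is affine in the multipliers with slope minus the balance; this is
    the source of the subgradient. *)
Lemma lagrangian_shift p q x :
  lagrangian q x = lagrangian p x + dot (fun c => p c - q c) (balance x).
Proof. by rewrite /lagrangian /dot; ring. Qed.

Lemma solves_subproblems_box p x : solves_subproblems p x -> box x.
Proof.
by move=> [x_max conv_max]; split=> [c|]; [case: (x_max c) | case: conv_max].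
Qed.

Lemma solves_subproblems_max p x y : solves_subproblems p x -> box y ->
  lagrangian p y <= lagrangian p x.
Proof.
move=> [x_max [_ conv_max]] [y_box yc_box]; rewrite !lagrangianE.
have carrier_le c := (x_max c).2 _ (y_box c).
exact: lerD (lerD (lerD (carrier_le _) (carrier_le _)) (carrier_le _)) (conv_max _ yc_box).
Qed.

(** An explicit optimum: each objective is separable over a box, so full acceptance of exactly the
    orders with positive gain is best. It shows that the dual supremum is attained and yields its
    closed form. *)
Definition bang_bang p : allocation M :=
  Allocation (fun c o => (0 < @order_gain p c o)%R%:R)
             (fun d co => (0 < @conv_gain p d co)%R%:R).

Lemma le_pos_part (a t : R) : 0 <= t <= 1 -> a * t <= Num.max 0 a.
Proof. by move=> /andP[t0 t1]; rewrite le_max; case: (leP a 0) => a0; nra. Qed.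

Lemma pos_partE (a : R) : a * (0 < a)%R%:R = Num.max 0 a.
Proof. by case: (ltP 0 a) => _; rewrite ?mulr1 ?mulr0. Qed.

Lemma bang_bang_solves p : solves_subproblems p (bang_bang p).
Proof.
have bool01 (b : bool) : 0 <= (b%:R : R) <= 1 by case: b; rewrite /= ?lexx ?ler01.
split=> [c|]; split=> [|y y_box]; try by move=> *; exact: bool01.
  rewrite !carrier_objectiveE; apply: ler_sum => o _ /=.
  by rewrite pos_partE le_pos_part // y_box.
rewrite !conv_objectiveE; apply: lerD; apply: ler_sum => co _ /=.
  by rewrite pos_partE le_pos_part // y_box.
by rewrite pos_partE le_pos_part // y_box.
Qed.

Lemma dual_function_max p x : solves_subproblems p x ->
  dual_function M p = lagrangian p x.
Proof.
move=> x_sol; have x_box := solves_subproblems_box x_sol.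
have ub : ubound [set lagrangian p y | y in box (M := M)] (lagrangian p x).
  by move=> _ [y y_box <-]; exact: solves_subproblems_max.
apply/eqP; rewrite eq_le; apply/andP; split.
  by apply: ge_sup => //; exists (lagrangian p x), x.
by apply: ub_le_sup; [exists (lagrangian p x) | exists x].
Qed.

Lemma lagrangian_le_dual p x : box x -> lagrangian p x <= dual_function M p.
Proof.
rewrite (dual_function_max (bang_bang_solves p)).
exact/solves_subproblems_max/bang_bang_solves.
Qed.

Lemma dual_functionE p :
  dual_function M p =
  (\sum_o Num.max 0 (@order_gain p Gas o))
  + (\sum_o Num.max 0 (@order_gain p Electricity o))
  + (\sum_o Num.max 0 (@order_gain p Heat o))
  + ((\sum_co Num.max 0 (@conv_gain p GasToElectricity co))
  + \sum_co Num.max 0 (@conv_gain p GasToHeat co)).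
Proof.
rewrite (dual_function_max (bang_bang_solves p)) lagrangianE conv_objectiveE.
rewrite !carrier_objectiveE /=.
by do ?congr (_ + _); apply: eq_bigr => o _; rewrite pos_partE.
Qed.

Lemma dual_function_max_affine : max_affine (dual_function M).
Proof.
have order_aff c : @max_affine R (fun p => \sum_o Num.max 0 (@order_gain p c o)).
  apply: max_affine_sum => o; case: c o => o.
  - apply: (@max_affine_pos _ _ (price o * qty o, - qty o, 0, 0)) => p.
    by rewrite /affine /order_gain /=; ring.
  - apply: (@max_affine_pos _ _ (price o * qty o, 0, - qty o, 0)) => p.
    by rewrite /affine /order_gain /=; ring.
  - apply: (@max_affine_pos _ _ (price o * qty o, 0, 0, - qty o)) => p.
    by rewrite /affine /order_gain /=; ring.
have conv_aff d : @max_affine R (fun p => \sum_co Num.max 0 (@conv_gain p d co)).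
  apply: max_affine_sum => co; case: d co => co.
  - apply: (@max_affine_pos _ _ (- (conv_price co * capacity co), - capacity co,
                            efficiency co * capacity co, 0)) => p.
    by rewrite /affine /conv_gain /=; ring.
  - apply: (@max_affine_pos _ _ (- (conv_price co * capacity co), - capacity co, 0,
                            efficiency co * capacity co)) => p.
    by rewrite /affine /conv_gain /=; ring.
rewrite (funext dual_functionE).
by do ![apply: order_aff | apply: conv_aff | apply: max_affineD].
Qed.

Lemma dual_function_ge0 p : 0 <= dual_function M p.
Proof.
by rewrite dual_functionE !addr_ge0 // sumr_ge0 // => o _; rewrite le_max lexx.
Qed.

Lemma dual_optimal_exists : exists p, dual_optimal M p.
Proof. exact: max_affine_min dual_function_max_affine dual_function_ge0. Qed.

Lemma weighted_sum_bounded (I : finType) (a : I -> R) :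
  exists B, forall t : I -> R, (forall i, 0 <= t i <= 1) ->
    `|\sum_i a i * t i| <= B.
Proof.
exists (\sum_i `|a i|) => t t01; apply: le_trans (ler_norm_sum _ _ _) _.
apply: ler_sum => i _; have /andP[t0 t1] := t01 i.
by rewrite normrM (ger0_norm t0) ler_piMr.
Qed.

Lemma balance_bounded : exists B, forall x c, box x -> `|balance x c| <= B.
Proof.
have vol c := weighted_sum_bounded (fun o : Defs.order_set M c => qty o).
have inp d := weighted_sum_bounded (fun co : conv_set M d => capacity co).
have out d :=
  weighted_sum_bounded (fun co : conv_set M d => efficiency co * capacity co).
have [Bv vP] := choice vol; have [Bi iP] := choice inp; have [Bo oP] := choice out.
(* Each summand bounds an absolute value and so is nonnegative; the total therefore dominates the
   balance of every carrier. *)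
exists (Bv Gas + Bv Electricity + Bv Heat + Bi GasToElectricity + Bi GasToHeat
        + Bo GasToElectricity + Bo GasToHeat) => x c [x_box xc_box].
have := vP _ _ (x_box Gas); have := vP _ _ (x_box Electricity).
have := vP _ _ (x_box Heat).
have := iP _ _ (xc_box GasToElectricity); have := iP _ _ (xc_box GasToHeat).
have := oP _ _ (xc_box GasToElectricity); have := oP _ _ (xc_box GasToHeat).
rewrite -/(conv_output _ _) -/(conv_output _ _) -/(conv_input _ _).
rewrite -/(conv_input _ _) -!/(order_volume _).
by case: c; rewrite /balance !ler_norml; lra.
Qed.

Lemma dual_subgradient p q x : solves_subproblems p x ->
  dual_function M p + dot (fun c => p c - q c) (balance x) <= dual_function M q.
Proof.
move=> x_sol; rewrite (dual_function_max x_sol) -lagrangian_shift.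
exact/lagrangian_le_dual/(solves_subproblems_box x_sol).
Qed.

(** The subgradient inequality at [p], whose slope is a balance and hence bounded by [B] in each
    coordinate. *)
Lemma dual_lipschitz : exists L, forall p q, dual_function M p <= dual_function M q
  + L * (`|q Gas - p Gas| + `|q Electricity - p Electricity| + `|q Heat - p Heat|).
Proof.
have [B B_ge] := balance_bounded; exists B => p q.
have x_sol := bang_bang_solves p; set x := bang_bang p in x_sol.
have x_box := solves_subproblems_box x_sol.
have := dual_subgradient q x_sol; rewrite /dot.
have le_B c : (q c - p c) * balance x c <= B * `|q c - p c|.
  apply: le_trans (ler_norm _) _.
  by rewrite normrM mulrC ler_wpM2r // B_ge.
have := le_B Gas; have := le_B Electricity; have := le_B Heat; lra.
Qed.

End Dual.

(** * Series with nonnegative terms, and reduction of the market iteration to the subgradient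
    method *)

Lemma nneseries_unbounded (R : realType) (u : nat -> R) N (A : R) :
  (forall k, (N <= k)%N -> 0 <= u k) -> (\sum_(N <= k <oo) (u k)%:E = +oo)%E ->
  exists n, A < \sum_(N <= k < n) u k.
Proof.
move=> u0 u_sum; apply: contrapT => no_n.
have : (\sum_(N <= k <oo) (u k)%:E <= A%:E)%E.
  apply: lime_le; first by apply: is_cvg_nneseries => k Nk _; rewrite lee_fin u0.
  apply: nearW => n; rewrite sumEFin lee_fin leNgt; apply/negP => An.
  by apply: no_n; exists n.
by rewrite u_sum leye_eq.
Qed.

Lemma nneseries_bounded (R : realType) (u : nat -> R) N :
  (forall k, (N <= k)%N -> 0 <= u k) -> (\sum_(N <= k <oo) (u k)%:E < +oo)%E ->
  exists C, forall n, \sum_(N <= k < n) u k <= C.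
Proof.
move=> u0 u_sum; exists (fine (\sum_(N <= k <oo) (u k)%:E)) => n.
have u_ge0 k : (N <= k)%N -> xpredT k -> (0 <= (u k)%:E)%E.
  by move=> Nk _; rewrite lee_fin u0.
rewrite -lee_fin -sumEFin fineK; first by apply: nneseries_lim_ge => k Nk; exact: u_ge0.
by rewrite ge0_fin_numE // nneseries_ge0.
Qed.

Theorem proposition7 (R : realType) (M : market R)
  (mu : nat -> R)
  (mu_ge0 : forall k : nat, (1 <= k)%N -> 0 <= mu k)
  (mu_cvg0 : mu k @[k --> \oo] --> (0 : R))
  (mu_sum : (\sum_(1 <= k <oo) (mu k)%:E = +oo)%E)
  (mu_sum_sqr : (\sum_(1 <= k <oo) (mu k ^+ 2)%:E < +oo)%E)
  (pi : nat -> carrier -> R) (x : nat -> allocation M)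
  (x_solves : forall k : nat, (1 <= k)%N -> solves_subproblems (pi k) (x k))
  (pi_update : forall (k : nat) (c : carrier), (1 <= k)%N ->
     pi k.+1 c = pi k c + mu k * balance (x k) c) :
  exists2 pi_star : carrier -> R,
    dual_optimal M pi_star &
    forall c : carrier, pi k c @[k --> \oo] --> pi_star c.
Proof.
have [B B_ge] := balance_bounded M; have [L L_lip] := dual_lipschitz M.
(* The market iteration starts at index 1 and the subgradient method at 0, so all sequences are
   shifted by one. *)
have pi_step k c : pi k.+2 c = pi k.+1 c + mu k.+1 * balance (x k.+1) c.
  exact: pi_update.
have [|||||||q q_opt pi_cvg] := @subgradient_method_cvg R (dual_function M) B L
    (fun k => mu k.+1) (fun k => pi k.+1) (fun k => balance (x k.+1)) _ pi_step.
- by move=> k; exact: mu_ge0.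
- by move=> k q; apply: dual_subgradient; exact: x_solves.
- move=> k c; apply: B_ge; apply: solves_subproblems_box; exact: x_solves.
(* At upper index 0 the sum from 1 is empty and so is the shifted one; otherwise reindexing lowers
   the upper index by one. *)
- move=> A; have [[|n]] := nneseries_unbounded A mu_ge0 mu_sum.
    by rewrite big_geq // => A0; exists 0%N; rewrite big_geq.
  by rewrite big_add1 => An; exists n.
- have [k _|C C_ge] := nneseries_bounded _ mu_sum_sqr; first exact: sqr_ge0.
  by exists C => _ [n _ <-]; have := C_ge n.+1; rewrite big_add1.
- exact: L_lip.
- exact: dual_optimal_exists.
exists q => // c; rewrite -(cvg_shiftS (fun k => pi k c)); exact: pi_cvg.
Qed.
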